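(* Let $m,k$ be integers with $1\le m$, $k\le N-1$, $k-m>1$, such that $$\phi^{m-1}-\phi^m>\phi^m-\phi^{m+1}=\cdots=\phi^{k-1}-\phi^k>\phi^k-\phi^{k+1},$$ and suppose there exist a labeled atom ${\tt Z}\in\aleph_k^\bullet$ and forests $F,G\in\tilde{\cal F}^{k-1}$ with ${\tt N}^{out}_{\tt Z}(F)\neq\emptyset$ and ${\tt N}^{out}_{\tt Z}(G)=\emptyset$. Then for every $l=m+1,\ldots,k-1$: 1) there exists a forest $H\in\tilde{\cal F}^l$ with ${\tt N}^{out}_{\tt Z}(H)\neq\emptyset$ and $H|_{\uparrow{\tt Z}}\in\tilde{\cal T}^\circ_{\tt Z}$; and for every $T\in\tilde{\cal T}^\circ_{\tt Z}$ there exists $Q\in\tilde{\cal F}^l$ with $Q|_{\uparrow{\tt Z}}=T$; 2) there exists a forest $S\in\tilde{\cal F}^l$ with ${\tt N}^{out}_{\tt Z}(S)=\emptyset$ and $S|_{\tt Z}\in\tilde{\cal T}^\bullet_{\tt Z}$; and for every $T\in\tilde{\cal T}^\bullet_{\tt Z}$ there exists $Q\in\tilde{\cal F}^l$ with $Q|_{\uparrow{\tt Z}}=Q|_{\tt Z}=T$.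
   Context: $V$ is a directed graph without loops on a finite vertex set ${\tt N}$, $|{\tt N}|=N$; each arc $(i,j)$ has a real weight $v_{ij}$; $V$ is assumed to have at least one spanning tree. An (entering) forest is a directed graph in which at most one arc leaves each vertex and there are no directed cycles; its components are trees, the root of a tree being its unique vertex with no outgoing arc. All forests and trees are subgraphs of $V$. For a subgraph $G$ and ${\tt D}\subseteq{\tt N}$, $\Upsilon^G_{\tt D}=\sum_{i\in{\tt D},(i,j)\in G}v_{ij}$ (heads may lie outside ${\tt D}$), $\Upsilon^G=\Upsilon^G_{\tt N}$. ${\cal F}^j$: spanning forests of $V$ with exactly $j$ trees; $\phi^j=\min_{F\in{\cal F}^j}\Upsilon^F$ ($\phi^j=\infty$ if ${\cal F}^j=\emptyset$; $\phi^0=\infty$); $\tilde{\cal F}^j$: forests in ${\cal F}^j$ of weight $\phi^j$. $\mathfrak{A}_k$: algebra of subsets of ${\tt N}$ generated by the vertex sets of all trees of all forests in $\tilde{\cal F}^k$; $\aleph_k$: its atoms (nonempty elements ${\tt A}$ with ${\tt A}\cap{\tt B}\in\{\emptyset,{\tt A}\}$ for all ${\tt B}\in\mathfrak{A}_k$); $\aleph_k^\bullet$: labeled atoms (containing a root of some tree of some $F\in\tilde{\cal F}^k$). For ${\tt D}\subseteq{\tt N}$: ${\cal T}^\bullet_{\tt D}$ is the set of trees with vertex set ${\tt D}$, $\lambda^\bullet_{\tt D}=\min_{T\in{\cal T}^\bullet_{\tt D}}\Upsilon^T$, $\tilde{\cal T}^\bullet_{\tt D}=\{T\in{\cal T}^\bullet_{\tt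 D}:\Upsilon^T=\lambda^\bullet_{\tt D}\}$; ${\cal T}^\circ_{\tt D}$ is the set of trees $T$ with $|{\tt V}T|=|{\tt D}|+1$, ${\tt D}\subset{\tt V}T$, and $T|_{\tt D}\in{\cal T}^\bullet_{\tt D}$; $\lambda^\circ_{\tt D}=\min_{T\in{\cal T}^\circ_{\tt D}}\Upsilon^T$, $\tilde{\cal T}^\circ_{\tt D}=\{T\in{\cal T}^\circ_{\tt D}:\Upsilon^T=\lambda^\circ_{\tt D}\}$. $G|_{\tt D}$ is the induced subgraph on ${\tt D}$. ${\tt N}^{out}_{\tt D}(G)$ is the set of heads $j\notin{\tt D}$ of arcs $(i,j)\in G$ with $i\in{\tt D}$. The outgoing restriction $G|_{\uparrow{\tt D}}$ has as arcs exactly the arcs of $G$ with tail in ${\tt D}$ and vertex set ${\tt D}\cup{\tt N}^{out}_{\tt D}(G)$.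
   Formalization: The trees in T°_D are additionally required to have their root outside D (the extra vertex is the root); without this an extra vertex sending an arc into D would be allowed and part 1 fails. *)

(* Defs.v *)
From mathcomp Require Import all_boot all_order all_algebra.
From mathcomp Require Import constructive_ereal.

Set Implicit Arguments.
Unset Strict Implicit.
Unset Printing Implicit Defensive.

Import Order.TTheory GRing.Theory Num.Theory.

Local Open Scope ring_scope.

(* A digraph on some of the vertices of T: its vertex set and its arc set.    *)
(* Subgraphs of the ambient graph have varying vertex sets, so the vertex set *)
(* is part of the data.                                                       *)
Notation digraph T := ({set T} * {set T * T})%type.

Section Digraphs.
Variable T : finType.
Implicit Types (G : digraph T) (D : {set T}) (e : rel T).

Definition vset G : {set T} := G.1.
Definition arcs G : {set T * T} := G.2.
Definition arc G : rel T := [rel i j | (i, j) \in arcs G].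

Definition subgraph e G :=
  [forall i, forall j, arc G i j ==> [&& e i j, i \in vset G & j \in vset G]].

Definition acyclic e := [forall i, forall j, e i j ==> ~~ connect e j i].

Lemma acyclicP e :
  reflect (forall c : seq T, ucycle e c -> c = [::]) (acyclic e).
Proof.
apply: (iffP idP) => [/forallP ac [//|x p] /andP[cxp _] | nocyc].
  case def_q: (rcons p x) (cxp) => [|y q]; first by case: (p) def_q.
  rewrite /cycle def_q /= => /andP[exy pq].
  have /forallP/(_ y)/implyP/(_ exy)/negP[] := ac x.
  apply/connectP; exists q => //.
  by rewrite -[last y q]/(last x (y :: q)) -def_q last_rcons.
apply/forallP => i; apply/forallP => j; apply/implyP => eij; apply/negP.
case/connectP => p0 ep0 def_i; move: def_i eij.
case/shortenP: ep0 => p ep up _ -> elj.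
suff: j :: p = [::] by [].
by apply: nocyc; apply/andP; split; rewrite //= rcons_path ep.
Qed.

Definition forest G :=
  acyclic (arc G) && [forall i, #|[set j | arc G i j]| <= 1]%N.

Definition induced G D : digraph T :=
  (vset G :&: D, [set a in arcs G | (a.1 \in D) && (a.2 \in D)]).

(* Components are taken in the undirected sense. *)
Definition components G : {set {set T}} :=
  equivalence_partition (connect [rel i j | arc G i j || arc G j i]) (vset G).

Definition trees_of G : {set digraph T} :=
  [set induced G C | C in components G].

Definition tree G := forest G && (#|components G| == 1)%N.

Definition roots G : {set T} :=
  [set i in vset G | [forall j, ~~ arc G i j]].

Definition outset D G : {set T} :=
  [set j | (j \notin D) && [exists i in D, arc G i j]].

Definition out_restr G D : digraph T :=
  (D :|: outset D G, [set a in arcs G | a.1 \in D]).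

Definition set_algebra (A : {set {set T}}) :=
  [&& setT \in A, [forall B in A, ~: B \in A]
    & [forall B in A, forall C in A, B :|: C \in A]].

Definition generated_algebra (X : {set {set T}}) : {set {set T}} :=
  \bigcap_(A : {set {set T}} | set_algebra A && (X \subset A)) A.

Definition atoms_of (A : {set {set T}}) : {set {set T}} :=
  [set B in A | (B != set0) &&
    [forall C in A, (B :&: C == set0) || (B :&: C == B)]].

End Digraphs.

Section Weighted.
Variables (R : realFieldType) (T : finType) (V : rel T) (v : T -> T -> R).
Implicit Types (G : digraph T) (D : {set T}) (j : nat).

Definition weight_on D G : R := \sum_(a in arcs G | a.1 \in D) v a.1 a.2.
Definition weight G : R := weight_on setT G.

(* The minimum over the empty family is +oo. *)
Definition min_weight (X : {set digraph T}) : \bar R :=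
  \big[mine/+oo%E]_(G in X) (weight G)%:E.
Definition minimizers (X : {set digraph T}) : {set digraph T} :=
  [set G in X | (weight G)%:E == min_weight X].

Definition forests j : {set digraph T} :=
  [set F | [&& subgraph V F, vset F == setT, forest F
             & #|trees_of F| == j]].
Definition phi j : \bar R := min_weight (forests j).
Definition min_forests j : {set digraph T} := minimizers (forests j).

Definition tree_algebra j : {set {set T}} :=
  generated_algebra (\bigcup_(F in min_forests j) [set vset C | C in trees_of F]).
Definition atoms j : {set {set T}} := atoms_of (tree_algebra j).
Definition labeled_atoms j : {set {set T}} :=
  [set A in atoms j |
    [exists F in min_forests j, exists C in trees_of F,
       A :&: roots C != set0]].

Definition trees_in D : {set digraph T} :=
  [set S | [&& subgraph V S, tree S & vset S == D]].
Definition min_trees_in D : {set digraph T} := minimizers (trees_in D).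

(* The additional vertex of a tree of [trees_out D] is its root: the tree     *)
(* consists of a tree on D and one arc going from the root of the latter to   *)
(* a vertex outside D.  Without the last condition, a tree on D extended by   *)
(* an arc entering D would also qualify.                                      *)
Definition trees_out D : {set digraph T} :=
  [set S | [&& subgraph V S, tree S, #|vset S| == #|D|.+1, D \subset vset S,
               induced S D \in trees_in D & [disjoint roots S & D]]].
Definition min_trees_out D : {set digraph T} := minimizers (trees_out D).

End Weighted.

(* Main.v *)
(* A spanning forest is a set of arcs; mix D A B takes the arcs of A with tail in
   D and those of B with tail outside D. If D is a union of trees of B, then
   mix D A B and mix D B A are forests, and the exchange preserves the total
   weight and the total number of roots. Hence phi is convex, and if c is its
   decrement on [m, k], minimum forests with j roots, m <= j <= k, are exactly
   the minimizers of weight + c * (number of roots): exchanges stay inside this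
   family. Since passing from one forest to another tree by tree raises the
   number of roots by at most one per step, every intermediate number of roots
   is realized.

   For a labelled atom Z of level k, exchanges inside min_forests k yield a
   forest B with k roots having Z as one of its trees. Comparing F with B shows
   that F leaves Z by a single arc, so that trees of both kinds on Z can be
   grafted onto B, giving minimum forests with k - 1 or k roots. Grafting the
   tree of the latter that contains Z onto a forest with m roots leaves at most
   m + 1 roots, and interpolation gives all l in between. *)
From mathcomp Require Import all_boot all_order all_algebra.
From mathcomp Require Import constructive_ereal zify lra.
Require Import Defs.

Set Implicit Arguments.
Unset Strict Implicit.
Unset Printing Implicit Defensive.

Import Order.TTheory GRing.Theory Num.Theory.

(** * Forests and their roots *)

Section AcyclicRelations.
Variable T : finType.
Implicit Types (e : rel T) (D : {set T}).

Lemma acyclic_sub e e' : subrel e e' -> acyclic e' -> acyclic e.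
Proof.
move=> ee' /forallP ac; apply/forallP => i; apply/forallP => j; apply/implyP.
move=> eij; have /forallP/(_ j)/implyP/(_ (ee' _ _ eij)) := ac i.
apply: contra; apply: connect_sub => x y exy; exact/connect1/ee'.
Qed.

(** Along a cycle [h] cannot drop and come back, so it is constant there and the whole cycle
    consists of arcs of a single acyclic [E n]. *)
Lemma acyclic_levels e (h : T -> nat) (E : nat -> rel T) :
  (forall n, acyclic (E n)) ->
  (forall i j, e i j -> h j < h i \/ h j = h i /\ E (h i) i j) -> acyclic e.
Proof.
move=> acE he; apply/forallP => i; apply/forallP => j; apply/implyP => eij.
apply/negP => /connectP[p].
have hle x y : e x y -> h y <= h x by case/he => [/ltnW|[->]].
have hp x q : path e x q -> h (last x q) <= h x.
  elim: q x => //= y q IH x /andP[/hle hyx /IH hl]; exact: leq_trans hl hyx.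
have hEp x q : path e x q -> h x <= h (last x q) -> path (E (h x)) x q.
  elim: q x => //= y q IH x /andP[exy pq] hx.
  have hlt := leq_trans hx (hp _ _ pq).
  case: (he _ _ exy) => [|[hyx Exy]]; first by rewrite ltnNge hlt.
  by rewrite Exy -{1}hyx; apply: IH => //; rewrite hyx.
move=> pp def_i; have hij : h i <= h j by rewrite def_i; exact: hp.
case: (he _ _ eij) => [|[hji Eij]]; first by rewrite ltnNge hij.
have /forallP/(_ i)/forallP/(_ j)/implyP/(_ Eij)/negP[] := acE (h i).
by apply/connectP; exists p => //; rewrite -hji; apply: hEp; rewrite -?def_i ?hji.
Qed.

(** Take a vertex reachable from [i] that itself reaches the fewest vertices: an arc out of it would
    lead to a vertex reaching strictly fewer, as acyclicity forbids the way back. *)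
Lemma acyclic_sink e i :
  acyclic e -> exists2 r, connect e i r & forall j, ~~ e r j.
Proof.
move=> /forallP ac.
case: (arg_minnP (fun r => #|connect e r|) (connect0 e i)) => r er min_r.
exists r => // j; apply/negP => erj.
have := min_r j (connect_trans er (connect1 erj)); apply/negP; rewrite -ltnNge.
apply: proper_card; apply/properP; split.
  by apply/subsetP => x; apply: connect_trans (connect1 erj).
exists r; first exact: connect0.
by have /forallP/(_ j)/implyP/(_ erj) := ac r.
Qed.

End AcyclicRelations.

Section Forests.
Variable T : finType.
Implicit Types (G : digraph T) (D : {set T}) (A B : {set T * T}).

Definition spanning A : digraph T := (setT, A).

(** Read off the arc set alone, so vertices outside [vset G] are sinks of [arcs G] too; hence the
    intersection in [rootsE]. *)
Definition sinks A : {set T} := [set i | [forall j, (i, j) \notin A]].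

Lemma sinksP A i : reflect (forall j, ~~ arc (spanning A) i j) (i \in sinks A).
Proof. by rewrite inE; apply: forallP. Qed.

Lemma rootsE G : roots G = vset G :&: sinks (arcs G).
Proof. by apply/setP => i; rewrite !inE. Qed.

Lemma forestP G :
  reflect (acyclic (arc G) /\ forall i j j', arc G i j -> arc G i j' -> j = j')
          (forest G).
Proof.
apply: (iffP andP) => -[ac fn]; split=> //.
  move=> i j j' ij ij'; have /card_le1_eqP := forallP fn i.
  by apply; rewrite inE.
apply/forallP => i; apply/card_le1_eqP => j j'; rewrite !inE => ij ij'; exact: fn ij' ij.
Qed.

Lemma forest_acyclic G : forest G -> acyclic (arc G).
Proof. by case/forestP. Qed.

Lemma forest_fun G i j j' : forest G -> arc G i j -> arc G i j' -> j = j'.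
Proof. by case/forestP => _; apply. Qed.

Lemma forest_sub G G' :
  arcs G \subset arcs G' -> forest G' -> forest G.
Proof.
move=> /subsetP sGG' /forestP[ac fn]; apply/forestP; split.
  by apply: acyclic_sub ac => i j /sGG'.
by move=> i j j' /sGG' ij /sGG'; apply: fn ij.
Qed.

Lemma connect_step G i j r :
  forest G -> arc G i j -> r \in sinks (arcs G) ->
  connect (arc G) i r = connect (arc G) j r.
Proof.
move=> fG ij /sinksP sr; apply/idP/idP; last exact/connect_trans/connect1.
case/connectP => -[_ ir|x p /= /andP[ix pp] def_r].
  by have := sr j; rewrite ir -[arc _ _ _]/(arc G i j) ij.
by rewrite (forest_fun fG ij ix); apply/connectP; exists p.
Qed.

(** [closed] asks that both ends of every arc lie on the same side. Closed sets are thus the unions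
    of trees, and exchanges are stated in terms of them. *)
Lemma closed_connect_sink G r :
  forest G -> r \in sinks (arcs G) -> closed (arc G) [set i | connect (arc G) i r].
Proof. by move=> fG sr i j ij; rewrite !inE (connect_step fG ij sr). Qed.

Lemma connect_sink G r i : r \in sinks (arcs G) -> connect (arc G) r i -> r = i.
Proof.
move=> /sinksP sr /connectP[[|x p] //= /andP[rx _] _].
by have := sr x; rewrite -[arc _ _ _]/(arc G r x) rx.
Qed.

Lemma sink_unique G i r r' : forest G ->
  r \in sinks (arcs G) -> r' \in sinks (arcs G) ->
  connect (arc G) i r -> connect (arc G) i r' -> r = r'.
Proof.
move=> fG sr sr' ir ir'; apply: (connect_sink sr).
have := closed_connect (closed_connect_sink fG sr') ir.
by rewrite !inE ir' => <-.
Qed.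

Lemma forest_sink G i : forest G ->
  exists2 r, connect (arc G) i r & r \in sinks (arcs G).
Proof.
move=> /forest_acyclic/(acyclic_sink i)[r ir sr]; exists r => //.
exact/sinksP.
Qed.

Local Notation uarc G := [rel i j | arc G i j || arc G j i].

Lemma closed_uarc G D : closed (arc G) D -> closed (uarc G) D.
Proof. by move=> cD i j /orP[/cD|/cD->]. Qed.

Lemma uarc_sym G : symmetric (connect (uarc G)).
Proof. by apply: sym_connect_sym => x y /=; rewrite orbC. Qed.

Lemma uconnect G i j : connect (arc G) i j -> connect (uarc G) i j.
Proof. by apply: connect_sub => x y xy; apply: connect1; rewrite /= xy. Qed.

Lemma uconnect_sink G i r : forest G -> r \in sinks (arcs G) ->
  connect (uarc G) i r = connect (arc G) i r.
Proof.
move=> fG sr; apply/idP/idP; last exact: uconnect.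
move/(closed_connect (closed_uarc (closed_connect_sink fG sr))).
by rewrite !inE connect0.
Qed.

Lemma subgraph_vset e G i j :
  subgraph e G -> arc G i j -> (i \in vset G) && (j \in vset G).
Proof. by move=> /forallP/(_ i)/forallP/(_ j)/implyP H /H /and3P[_ -> ->]. Qed.

Lemma connect_vset e G i j :
  subgraph e G -> connect (arc G) i j -> (i \in vset G) = (j \in vset G).
Proof.
move=> sG; apply: closed_connect => x y /(subgraph_vset sG).
by case/andP => -> ->.
Qed.

(** Sending a root to its undirected component is a bijection: every vertex leads to a root, and two
    distinct roots never share a component. *)
Lemma card_components e G :
  subgraph e G -> forest G -> #|components G| = #|roots G|.
Proof.
move=> sG fG; pose C r := [set i in vset G | connect (uarc G) r i].
have sinkr r : r \in roots G -> r \in sinks (arcs G).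
  by rewrite rootsE => /setIP[].
have -> : components G = [set C r | r in roots G].
  apply/setP => D; apply/imsetP/imsetP => -[i iG ->]; last first.
    by exists i => //; move: iG; rewrite rootsE => /setIP[].
  have [r ir sr] := forest_sink i fG; exists r.
    by rewrite rootsE inE sr -(connect_vset sG ir) iG.
  apply/setP => j; rewrite !inE; case: (j \in vset G) => //=.
  have ur : connect (uarc G) i r by exact: uconnect.
  apply/idP/idP; last exact: connect_trans ur.
  by apply: connect_trans; rewrite uarc_sym.
rewrite card_in_imset // => r r' rG r'G.
move=> /setP/(_ r'); rewrite !inE connect0 andbT.
have r'V : r' \in vset G by move: r'G; rewrite rootsE => /setIP[].
rewrite r'V uconnect_sink ?sinkr //.
exact: connect_sink (sinkr _ rG).
Qed.

Lemma card_trees_of e G :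
  subgraph e G -> forest G -> #|trees_of G| = #|roots G|.
Proof.
move=> sG fG; rewrite -(card_components sG fG) card_in_imset //.
move=> C C' /imsetP[i _ ->] /imsetP[j _ ->] [].
set D := [set _ in _ | _]; set D' := [set _ in _ | _].
have /setIidPr -> : D \subset vset G by apply/subsetP => x; rewrite inE => /andP[].
by have /setIidPr -> : D' \subset vset G by apply/subsetP => x; rewrite inE => /andP[].
Qed.

Lemma tree_root e G : subgraph e G -> tree G -> exists r, roots G = [set r].
Proof.
by move=> sG /andP[fG]; rewrite (card_components sG fG) => /cards1P.
Qed.

Lemma tree_connect e G r i : subgraph e G -> tree G -> roots G = [set r] ->
  i \in vset G -> connect (arc G) i r.
Proof.
move=> sG /andP[fG _] rG iG; have [r' ir' sr'] := forest_sink i fG.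
have : r' \in roots G by rewrite rootsE inE sr' -(connect_vset sG ir') iG.
by rewrite rG inE => /eqP <-.
Qed.

Lemma one_root_tree e G r :
  subgraph e G -> forest G -> roots G = [set r] -> tree G.
Proof. by move=> sG fG rG; rewrite /tree fG (card_components sG fG) rG cards1. Qed.

End Forests.

(** * Exchange of arcs *)

Section Mixing.
Variable T : finType.
Implicit Types (D : {set T}) (A B : {set T * T}).

Definition mix D A B : {set T * T} := [set a | if a.1 \in D then a \in A else a \in B].

Lemma arc_mix D A B i j : arc (spanning (mix D A B)) i j =
  if i \in D then arc (spanning A) i j else arc (spanning B) i j.
Proof. by rewrite /arc /= inE. Qed.

Lemma mix_fun D A B : forest (spanning A) -> forest (spanning B) ->
  acyclic (arc (spanning (mix D A B))) -> forest (spanning (mix D A B)).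
Proof.
move=> fA fB ac; apply/forestP; split=> // i j j'; rewrite !arc_mix.
by case: ifP => _; exact: forest_fun.
Qed.

(** Arcs with tail in [D] stay in [D], so a cycle would lie either inside [D], among arcs of [A], or
    outside, among arcs of [B]. *)
Lemma forest_mix_inward D A B : forest (spanning A) -> forest (spanning B) ->
  (forall i j, i \in D -> arc (spanning A) i j -> j \in D) ->
  forest (spanning (mix D A B)).
Proof.
move=> fA fB clA; apply: mix_fun => //.
apply: (acyclic_levels (h := fun i => i \notin D)
         (E := fun n => arc (spanning (if n == 0 then A else B)))).
  by case=> [|n]; apply: forest_acyclic.
move=> i j; rewrite arc_mix; case: ifP => iD ij.
  by right; rewrite (clA _ _ iD ij).
by case jD: (j \in D); [left | right].
Qed.

Lemma forest_mix_outward D A B : forest (spanning A) -> forest (spanning B) ->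
  (forall i j, i \notin D -> arc (spanning B) i j -> j \notin D) ->
  forest (spanning (mix D A B)).
Proof.
move=> fA fB clB.
have -> : mix D A B = mix (~: D) B A.
  by apply/setP => a; rewrite !inE; case: ifP.
by apply: forest_mix_inward => // i j; rewrite !inE; apply: clB.
Qed.

Lemma subgraph_mix e D A B : subgraph e (spanning A) -> subgraph e (spanning B) ->
  subgraph e (spanning (mix D A B)).
Proof.
move=> /forallP sA /forallP sB; apply/forallP => i; apply/forallP => j.
rewrite arc_mix; case: ifP => _; first exact: (forallP (sA i)).
exact: (forallP (sB i)).
Qed.

Lemma sinks_mix D A B : sinks (mix D A B) = (sinks A :&: D) :|: (sinks B :\: D).
Proof.
apply/setP => i; rewrite !inE; case iD: (i \in D); rewrite ?andbT ?andbF ?orbF /=;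
by apply: eq_forallb => j; rewrite inE /= iD.
Qed.

Lemma card_sinks_mix D A B :
  #|sinks (mix D A B)| = #|sinks A :&: D| + #|sinks B :\: D|.
Proof.
rewrite sinks_mix cardsU [X in _ - X](_ : _ = 0) ?subn0 //.
by apply: eq_card0 => i; rewrite !inE; case: (i \in D); rewrite ?andbF.
Qed.

Lemma card_sinks_exchange D A B :
  #|sinks (mix D A B)| + #|sinks (mix D B A)| = #|sinks A| + #|sinks B|.
Proof. by rewrite !card_sinks_mix -(cardsID D (sinks A)) -(cardsID D (sinks B)); lia. Qed.

(* Passing from A to B one tree of B at a time, every step adds at most one
   root. *)
Lemma sinks_interpolation A B l : forest (spanning B) ->
  #|sinks A| <= l <= #|sinks B| ->
  exists2 D : {set T}, closed (arc (spanning B)) D & #|sinks (mix D B A)| = l.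
Proof.
move=> fB /andP[lA lB].
pose Ds s := [set i | has (connect (arc (spanning B)) i) s].
have clD s : {subset s <= sinks B} -> closed (arc (spanning B)) (Ds s).
  move=> sB i j ij; rewrite !inE; apply: eq_in_has => r /sB rB.
  exact: connect_step ij rB.
(* The list [s] holds the roots of the trees of [B] taken over. Start from all roots and drop one at
   a time while at least [l] sinks remain. *)
suff H s : {subset s <= sinks B} -> l <= #|sinks (mix (Ds s) B A)| ->
    exists2 D : {set T}, closed (arc (spanning B)) D & #|sinks (mix D B A)| = l.
  have sBD : sinks B \subset Ds (enum (sinks B)).
    apply/subsetP => i iB; rewrite inE; apply/hasP; exists i; first by rewrite mem_enum.
    exact: connect0.
  apply: (H (enum (sinks B))) => [i|]; first by rewrite mem_enum.
  by rewrite card_sinks_mix (setIidPl sBD) (leq_trans lB) ?leq_addr.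
elim: s => [|r s IH] sB lD.
  exists (Ds [::]); first exact: clD.
  apply/eqP; rewrite eqn_leq lD andbT card_sinks_mix.
  have -> : Ds [::] = set0 by apply/setP => i; rewrite !inE.
  by rewrite setI0 cards0 setD0.
have sB' : {subset s <= sinks B} by move=> i si; apply: sB; rewrite inE si orbT.
have rB : r \in sinks B by apply: sB; rewrite inE eqxx.
(* If dropping [r] leaves fewer than [l] sinks, the count before was exactly [l], because the tree
   of [r] has no other root. *)
have [/(IH sB')//|lDs] := leqP l #|sinks (mix (Ds s) B A)|.
exists (Ds (r :: s)); first exact: clD.
apply/eqP; rewrite eqn_leq lD andbT (leq_trans _ lDs) // !card_sinks_mix -addSn.
have sD : Ds s \subset Ds (r :: s).
  by apply/subsetP => i; rewrite !inE /= => ->; rewrite orbT.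
apply: leq_add; last exact/subset_leq_card/setDS.
have : #|sinks B :&: Ds (r :: s)| <= #|r |: (sinks B :&: Ds s)|.
  apply/subset_leq_card/subsetP => i /setIP[iB]; rewrite !inE /= => /orP[ir|xs].
    by rewrite (connect_sink (G := spanning B) iB ir) eqxx.
  by move: iB; rewrite inE => ->; rewrite xs orbT.
move=> /leq_trans; apply; rewrite cardsU1; by case: (r \notin _); rewrite ?leqnn ?leqnSn.
Qed.

End Mixing.

(** * Minimum weight and weight under exchange *)

Section Minimizers.
Local Open Scope ring_scope.
Variables (R : realFieldType) (T : finType) (v : T -> T -> R).
Implicit Types (G : digraph T) (X : {set digraph T}) (A B : {set T * T}).

Lemma minimizersP X G :
  reflect (G \in X /\ forall G', G' \in X -> weight v G <= weight v G')
          (G \in minimizers v X).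
Proof.
rewrite inE; apply: (iffP andP) => -[GX].
  move=> /eqP eG; split=> // G' G'X; rewrite -lee_fin eG.
  exact: bigmin_le_cond.
move=> minG; split=> //; apply/eqP/le_anti/andP; split; last exact: bigmin_le_cond.
apply/bigmin_geP; split=> [|G' G'X]; first exact: leey.
by rewrite lee_fin minG.
Qed.

Lemma minimizers_neq0 X : X != set0 -> exists G, G \in minimizers v X.
Proof.
case/set0Pn => G0 G0X; case: (Order.TotalTheory.arg_minP (weight v) G0X) => G GX minG.
by exists G; apply/minimizersP.
Qed.

Lemma min_weightE X G : G \in minimizers v X -> min_weight v X = (weight v G)%:E.
Proof. by rewrite inE => /andP[_ /eqP]. Qed.

Lemma weight_mix D A B : weight v (spanning (mix D A B)) =
  weight_on v D (spanning A) + weight_on v (~: D) (spanning B).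
Proof.
rewrite /weight /weight_on (bigID (fun a => a.1 \in D)) /=; congr (_ + _).
  by apply: eq_bigl => a; rewrite !inE; case: (a.1 \in D); rewrite ?andbT ?andbF.
by apply: eq_bigl => a; rewrite !inE; case: (a.1 \in D); rewrite ?andbT ?andbF.
Qed.

Lemma weight_split D A : weight v (spanning A) =
  weight_on v D (spanning A) + weight_on v (~: D) (spanning A).
Proof.
by rewrite -weight_mix; congr (weight v (spanning _));
   apply/setP => a; rewrite inE if_same.
Qed.

Lemma weight_exchange D A B :
  weight v (spanning (mix D A B)) + weight v (spanning (mix D B A)) =
  weight v (spanning A) + weight v (spanning B).
Proof. by rewrite !weight_mix (weight_split D A) (weight_split D B); lra. Qed.

End Minimizers.

(** * Optimal forests *)

Section SpanningForests.
Variables (T : finType) (V : rel T).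
Implicit Types (D : {set T}) (A B : {set T * T}).

Definition spanning_forest A := subgraph V (spanning A) && forest (spanning A).

Lemma spanning_forest_mix_inward D A B : spanning_forest A -> spanning_forest B ->
  (forall i j, i \in D -> arc (spanning A) i j -> j \in D) ->
  spanning_forest (mix D A B).
Proof.
move=> /andP[sA fA] /andP[sB fB] cl.
by rewrite /spanning_forest subgraph_mix // forest_mix_inward.
Qed.

Lemma spanning_forest_mix_outward D A B : spanning_forest A -> spanning_forest B ->
  (forall i j, i \notin D -> arc (spanning B) i j -> j \notin D) ->
  spanning_forest (mix D A B).
Proof.
move=> /andP[sA fA] /andP[sB fB] cl.
by rewrite /spanning_forest subgraph_mix // forest_mix_outward.
Qed.

Lemma spanning_forest_mix_closed D A B : spanning_forest A -> spanning_forest B ->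
  closed (arc (spanning B)) D -> spanning_forest (mix D B A).
Proof.
by move=> sA sB cl; apply: spanning_forest_mix_inward => // i j iD /cl <-.
Qed.

Lemma spanning_forest_mix_closedr D A B : spanning_forest A -> spanning_forest B ->
  closed (arc (spanning B)) D -> spanning_forest (mix D A B).
Proof.
by move=> sA sB cl; apply: spanning_forest_mix_outward => // i j iD /cl <-.
Qed.

Lemma roots_spanning A : roots (spanning A) = sinks A.
Proof. by rewrite rootsE setTI. Qed.

Lemma mem_forests A j :
  (spanning A \in forests V j) = spanning_forest A && (#|sinks A| == j).
Proof.
rewrite inE eqxx /= /spanning_forest; have [sA|] //= := boolP (subgraph V _).
by have [fA|] //= := boolP (forest _); rewrite (card_trees_of sA fA) roots_spanning.
Qed.

Lemma forests_spanning F j : F \in forests V j -> F = spanning (arcs F).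
Proof. by case: F => D A; rewrite inE => /and4P[_ /eqP /= -> _ _]. Qed.

Lemma spanning_forest_sink A : 0 < #|T| -> spanning_forest A -> 0 < #|sinks A|.
Proof.
move=> /card_gt0P[x _] /andP[_ fA]; have [r _ rA] := forest_sink x fA.
by apply/card_gt0P; exists r.
Qed.

(** Interpolate between a spanning tree, which has one root, and the arcless forest, where every
    vertex is a root. *)
Lemma forests_neq0 j : trees_in V setT != set0 -> 0 < j <= #|T| ->
  forests V j != set0.
Proof.
case/set0Pn => -[D A]; rewrite inE => /and3P[sA tA /eqP /= D_T].
move: sA tA; rewrite {D}D_T -/(spanning A) => sA tA /andP[j0 jT].
have [r rA] := tree_root sA tA; rewrite roots_spanning in rA.
have sA' : spanning_forest A by rewrite /spanning_forest sA; case/andP: tA.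
have s0 : spanning_forest set0.
  apply/andP; split.
    by apply/forallP => i; apply/forallP => k; rewrite /arc /= inE.
  by apply: forest_sub (proj2 (andP sA')); apply: sub0set.
have e0 : sinks (set0 : {set T * T}) = setT.
  by apply/setP => i; rewrite !inE; apply/forallP => k; rewrite inE.
have lt : #|sinks A| <= j <= #|sinks (set0 : {set T * T})|.
  by rewrite rA cards1 e0 cardsT j0.
have [D clD <-] := sinks_interpolation (proj2 (andP s0)) lt.
apply/set0Pn; exists (spanning (mix D set0 A)).
by rewrite mem_forests eqxx spanning_forest_mix_closed.
Qed.

End SpanningForests.

(** * Penalized weight and convexity of the minimum weights *)

Section Optimality.
Local Open Scope ring_scope.
Variables (R : realFieldType) (T : finType) (V : rel T) (v : T -> T -> R).
Implicit Types (D : {set T}) (A B : {set T * T}) (c : R).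

(** A Lagrangian: the constraint on the number of roots is replaced by a price [c] per root. *)
Definition cost c A : R := weight v (spanning A) + c *+ #|sinks A|.

(* As phi is affine with slope -c on [m, k], the optimal forests with j roots,
   m <= j <= k, are exactly the members of min_forests j. *)
Definition optimal c A :=
  spanning_forest V A && [forall B, spanning_forest V B ==> (cost c A <= cost c B)].

Lemma optimal_forest c A : optimal c A -> spanning_forest V A.
Proof. by case/andP. Qed.

Lemma optimal_le c A B : optimal c A -> spanning_forest V B -> cost c A <= cost c B.
Proof. by case/andP => _ /forallP/(_ B)/implyP. Qed.

Lemma cost_optimal c A B : optimal c A -> spanning_forest V B ->
  cost c B <= cost c A -> optimal c B.
Proof.
move=> oA sB le; rewrite /optimal sB; apply/forallP => C; apply/implyP => sC.
exact: le_trans le (optimal_le oA sC).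
Qed.

Lemma cost_exchange c D A B :
  cost c (mix D A B) + cost c (mix D B A) = cost c A + cost c B.
Proof.
rewrite /cost addrACA [RHS]addrACA weight_exchange -!mulrnDr.
by rewrite card_sinks_exchange.
Qed.

(** The exchange preserves the sum of the two costs, and neither result can go below the minimum, so
    both attain it. *)
Lemma optimal_exchange c D A B : optimal c A -> optimal c B ->
  spanning_forest V (mix D A B) -> spanning_forest V (mix D B A) ->
  optimal c (mix D A B).
Proof.
move=> oA oB s s'; apply: cost_optimal oA s _.
have := cost_exchange c D A B; have := optimal_le oB s'; lra.
Qed.

Lemma optimal_mix_closed c D A B : optimal c A -> optimal c B ->
  closed (arc (spanning B)) D -> optimal c (mix D B A).
Proof.
move=> oA oB cl; have [sA sB] := (optimal_forest oA, optimal_forest oB).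
apply: optimal_exchange => //; first exact: spanning_forest_mix_closed.
exact: spanning_forest_mix_closedr.
Qed.

Lemma optimal_mix_closedr c D A B : optimal c A -> optimal c B ->
  closed (arc (spanning B)) D -> optimal c (mix D A B).
Proof.
move=> oA oB cl; have [sA sB] := (optimal_forest oA, optimal_forest oB).
apply: optimal_exchange => //; first exact: spanning_forest_mix_closedr.
exact: spanning_forest_mix_closed.
Qed.

Lemma forests_min j : trees_in V setT != set0 -> (0 < j <= #|T|)%N ->
  exists2 A, spanning A \in min_forests V v j
    & phi V v j = (weight v (spanning A))%:E.
Proof.
move=> hT hj; have [F Fj] := minimizers_neq0 v (forests_neq0 hT hj).
have Fs : F = spanning (arcs F) by have /minimizersP[/forests_spanning] := Fj.
by exists (arcs F); rewrite -Fs //; apply: min_weightE.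
Qed.

Lemma phi_le j A : trees_in V setT != set0 -> (0 < j <= #|T|)%N ->
  spanning_forest V A -> #|sinks A| = j -> fine (phi V v j) <= weight v (spanning A).
Proof.
move=> hT hj sA Aj; have [B Bj ->] := forests_min hT hj.
by have /minimizersP[_] := Bj; apply; rewrite mem_forests sA Aj eqxx.
Qed.

(* Exchange as many trees as needed between forests with j and j + 2 roots to
   get two forests with j + 1 roots. *)
Lemma phi_convex j : trees_in V setT != set0 -> (0 < j)%N -> (j + 2 <= #|T|)%N ->
  fine (phi V v (j + 1)) *+ 2 <= fine (phi V v j) + fine (phi V v (j + 2)).
Proof.
move=> hT j0 jT.
have [|A Aj ->] := @forests_min j hT; first lia.
have [|B Bj ->] := @forests_min (j + 2) hT; first lia.
have /minimizersP[+ _] := Aj; rewrite mem_forests => /andP[sA /eqP cA].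
have /minimizersP[+ _] := Bj; rewrite mem_forests => /andP[sB /eqP cB].
have [|D clD cD] := @sinks_interpolation _ A B (j + 1) (proj2 (andP sB)); first lia.
have cD' := card_sinks_exchange D A B; rewrite cD cA cB in cD'.
have h1 := @phi_le (j + 1) _ hT _ (spanning_forest_mix_closed sA sB clD) cD.
have h2 := @phi_le (j + 1) _ hT _ (spanning_forest_mix_closedr sA sB clD) _.
rewrite -(weight_exchange v D) mulr2n addrC lerD //; [apply: h1|apply: h2]; lia.
Qed.

(** The line of slope [- c] through the point of [f] at [k] supports [f] from below, strictly to the
    right of [k] because the decrements there are already smaller than [c]. *)
Lemma convex_touch (f : nat -> R) N k c :
  (forall j, (0 < j)%N -> (j + 2 <= N)%N -> f (j + 1)%N *+ 2 <= f j + f (j + 2)%N) ->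
  (1 < k < N)%N -> f (k - 1)%N - f k = c -> f k - f (k + 1)%N < c ->
  forall j, (0 < j <= N)%N ->
    f k + c *+ k <= f j + c *+ j /\ ((k < j)%N -> f k + c *+ k < f j + c *+ j).
Proof.
move=> cvx /andP[k1 kN] fc fk.
(* By convexity the decrements never increase: they stay below [c] after [k] and are at least [c]
   before it. [upS] and [downS] sum them. *)
have up i : (k + i + 1 <= N)%N -> f (k + i)%N - f (k + i + 1)%N < c.
  elim: i => [|i IH] iN; first by rewrite addn0.
  have := IH ltac:(lia); have := cvx (k + i)%N ltac:(lia) ltac:(lia).
  by rewrite !addnS !addn0 mulr2n => h1 h2; lra.
have down i : (0 < k - 1 - i)%N -> c <= f (k - 1 - i)%N - f (k - 1 - i + 1)%N.
  elim: i => [|i IH] ik; first by rewrite subn0 subnK ?fc // ltnW.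
  have := IH ltac:(lia); have := cvx (k - 1 - i.+1)%N ltac:(lia) ltac:(lia).
  have -> : (k - 1 - i.+1 + 1 = k - 1 - i)%N by lia.
  have -> : (k - 1 - i.+1 + 2 = k - 1 - i + 1)%N by lia.
  by rewrite mulr2n => h1 h2; lra.
have upS i : (k + i + 1 <= N)%N -> f k + c *+ k < f (k + i + 1)%N + c *+ (k + i + 1).
  elim: i => [|i IH] iN; have := up _ iN; rewrite ?addnS ?addn0 !mulrS.
    by move: (c *+ k) => x; lra.
  have := IH ltac:(lia); rewrite ?addnS ?addn0 !mulrS.
  move: (c *+ k) (c *+ (k + i)) => x y. lra.
have downS i : (i < k)%N -> f k + c *+ k <= f (k - i)%N + c *+ (k - i).
  elim: i => [|i IH] ik; first by rewrite subn0.
  have := down i ltac:(lia); have := IH ltac:(lia).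
  have -> : (k - 1 - i = k - i.+1)%N by lia.
  have -> : (k - i = k - i.+1 + 1)%N by lia.
  by rewrite addn1 mulrS; move: (c *+ k) (c *+ (k - i.+1)) => x y; lra.
move=> j /andP[j0 jN]; have [jk|kj] := leqP j k.
  by split=> //; have := downS (k - j)%N ltac:(lia); rewrite subKn.
have := upS (j - k - 1)%N; have -> : (k + (j - k - 1) + 1 = j)%N by lia.
by move=> /(_ jN) lt; split=> //; apply: ltW.
Qed.

Lemma min_forests_optimal m k : trees_in V setT != set0 ->
  (1 <= m)%N -> (k <= #|T| - 1)%N -> (k - m > 1)%N ->
  (forall j : nat, (m <= j <= k - 1)%N ->
    (phi V v j - phi V v (j + 1) = phi V v m - phi V v (m + 1))%E) ->
  (phi V v (k - 1) - phi V v k > phi V v k - phi V v (k + 1))%E ->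
  exists c,
    (forall j A, (m <= j <= k)%N -> spanning A \in min_forests V v j =
       optimal c A && (#|sinks A| == j)) /\
    (forall A, optimal c A -> (#|sinks A| <= k)%N).
Proof.
move=> hT m1 kN km eq_phi lt_phi; pose f j := fine (phi V v j).
(* In this range the minimum is over a nonempty family, so [fine] loses nothing. *)
have phiE j : (0 < j <= #|T|)%N -> phi V v j = (f j)%:E.
  by move=> hj; rewrite /f; have [A _ ->] := forests_min hT hj.
pose c := f m - f (m + 1)%N.
have slope j : (m <= j <= k - 1)%N -> f j - f (j + 1)%N = c.
  move=> hj; have := eq_phi j hj; rewrite !phiE; try lia.
  by rewrite -!EFinB => -[].
have fc : f (k - 1)%N - f k = c.
  by rewrite -(slope (k - 1)%N) ?subnK //; lia.
have fk : f k - f (k + 1)%N < c.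
  by move: lt_phi; rewrite !phiE; try lia; rewrite -!EFinB lte_fin fc.
have touch := @convex_touch f #|T| k c (fun j => @phi_convex j hT) ltac:(lia) fc fk.
(* At this price the minimum cost over forests with [j] roots does not depend on [j] in [[m, k]]; by
   [touch] it is the global minimum. *)
have flat j : (m <= j <= k)%N -> f j + c *+ j = f k + c *+ k.
  move=> /andP[mj jk]; rewrite -(subKn jk); have : (k - j <= k - m)%N by lia.
  elim: (k - j)%N => [|i IH] ik; first by rewrite subn0.
  rewrite -(IH ltac:(lia)); have := slope (k - i.+1)%N ltac:(lia).
  have -> : (k - i = k - i.+1 + 1)%N by lia.
  by rewrite addn1 mulrS; move: (c *+ (k - i.+1)) => x; lra.
have range A : spanning_forest V A -> (0 < #|sinks A| <= #|T|)%N.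
  by move=> sA; rewrite max_card andbT (spanning_forest_sink _ sA) //; lia.
have lower A : spanning_forest V A -> f k + c *+ k <= cost c A.
  move=> sA; have [+ _] := touch _ (range _ sA); move=> /le_trans; apply.
  by rewrite lerD2r; apply: (phi_le hT (range _ sA)).
exists c; split=> [j A hj|A oA].
  apply/minimizersP/andP => -[].
    rewrite mem_forests => /andP[sA /eqP cA] minA; split; last exact/eqP.
    rewrite /optimal sA; apply/forallP => B; apply/implyP => sB.
    apply: le_trans (lower B sB); rewrite -(flat _ hj) /cost cA lerD2r.
    have [|C Cj eC] := @forests_min j hT; first lia.
    rewrite /f eC; apply: minA.
    by have /minimizersP[] := Cj.
  move=> oA /eqP cA; have sA := optimal_forest oA.
  split=> [|G Gj]; first by rewrite mem_forests sA cA eqxx.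
  have Gs := forests_spanning Gj; rewrite Gs mem_forests in Gj.
  have /andP[sG /eqP cG] := Gj.
  by have := optimal_le oA sG; rewrite /cost cA cG lerD2r -Gs.
(* With more than [k] roots the cost lies strictly above the supporting line, hence above that of a
   minimum forest with [k] roots. *)
rewrite leqNgt; apply/negP => kA; have sA := optimal_forest oA.
have [|B Bj eB] := @forests_min k hT; first lia.
have /minimizersP[+ _] := Bj; rewrite mem_forests => /andP[sB /eqP cB].
have [_ /(_ kA)] := touch _ (range _ sA); apply/negP; rewrite -leNgt.
apply: le_trans (_ : cost c A <= _); first
  by rewrite lerD2r; apply: (phi_le hT (range _ sA)).
by apply: le_trans (optimal_le oA sB) _; rewrite /cost cB /f eB.
Qed.

End Optimality.

(** * Labelled atoms *)

Section Atoms.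
Variable T : finType.
Implicit Types (D Z C : {set T}) (X : {set {set T}}) (A : {set T * T}).

Lemma atom_meet X Z C : Z \in atoms_of (generated_algebra X) -> C \in X ->
  (Z :&: C == set0) || (Z \subset C).
Proof.
rewrite inE => /and3P[_ _ /forallP/(_ C)/implyP H] CX.
by rewrite (sameP setIidPl eqP) H //; apply/bigcapP => A /andP[_ /subsetP]; apply.
Qed.

(** The sets that do not separate [x] from [z] form an algebra. If it contained every generator, it
    would contain [Z], which does separate them. *)
Lemma atom_separated X Z z x : Z \in atoms_of (generated_algebra X) ->
  z \in Z -> x \notin Z -> exists2 C, C \in X & (x \in C) != (z \in C).
Proof.
rewrite inE => /and3P[/bigcapP Zg _ _] zZ xZ.
have [/existsP[C /andP[CX sep]]|] := boolP [exists C in X, (x \in C) != (z \in C)].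
  by exists C.
rewrite negb_exists => /forallP nsep.
pose A := [set B : {set T} | (x \in B) == (z \in B)].
suff /Zg : set_algebra A && (X \subset A) by rewrite inE zZ (negPf xZ).
apply/andP; split; last first.
  apply/subsetP => C CX; rewrite inE; have := nsep C.
  by rewrite CX negbK.
apply/and3P; split; first by rewrite !inE.
  apply/forallP => B; apply/implyP; rewrite !inE => /eqP->; exact: eqxx.
apply/forallP => B; apply/implyP; rewrite inE => /eqP eB.
apply/forallP => C; apply/implyP; rewrite inE => /eqP eC.
by rewrite !inE eB eC.
Qed.

Lemma mem_component A C : C \in [set vset G | G in trees_of (spanning A)] ->
  closed (arc (spanning A)) C /\
  forall D z, closed (arc (spanning A)) D -> z \in C -> z \in D -> C \subset D.
Proof.
case/imsetP => G /imsetP[C0 /imsetP[x _ ->] ->] ->.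
set e := connect _; have es : symmetric e by exact: (@uarc_sym _ (spanning A)).
rewrite /induced /= setTI; split.
  move=> i j ij; rewrite !inE /=; have eij : e i j by apply: connect1; rewrite /= ij.
  apply/idP/idP => h; apply: connect_trans h _ => //; by rewrite -/e es.
move=> D z cl; rewrite !inE /= => xz zD; apply/subsetP => y; rewrite !inE /= => xy.
have cu := closed_connect (closed_uarc cl).
by rewrite -(cu _ _ xy) (cu _ _ xz).
Qed.

Lemma component_exists A z :
  exists2 C, C \in [set vset G | G in trees_of (spanning A)] & z \in C.
Proof.
pose C0 := [set i in [set: T] |
  connect [rel i j | arc (spanning A) i j || arc (spanning A) j i] z i].
exists (vset (induced (spanning A) C0)).
  by apply/imset_f/imset_f/imsetP; exists z.
by rewrite /induced /= !inE connect0.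
Qed.

(** A component is closed, so restricting to it removes no arc leaving [z]. *)
Lemma labelled_root A G z :
  G \in trees_of (spanning A) -> z \in roots G -> z \in sinks A.
Proof.
move=> GA; have [cl _] := mem_component (imset_f (@vset T) GA).
case/imsetP: GA cl => C _ ->; rewrite rootsE => cl /setIP[zC /sinksP sz].
apply/sinksP => j; apply: contra (sz j) => zj; have := cl _ _ zj.
move: zC zj; rewrite /arc /vset /= !inE /= => zC zj.
by rewrite zC zj => <-.
Qed.

End Atoms.

(** * Exchanges around an atom *)

Section IsolatedAtom.
Local Open Scope ring_scope.
Variables (R : realFieldType) (T : finType) (V : rel T) (v : T -> T -> R).
Variables (c : R) (k : nat) (Z : {set T}).
Implicit Types (D : {set T}) (A B F K : {set T * T}).

Definition optimal_at A := optimal V v c A && (#|sinks A| == k).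

Hypothesis optimal_card : forall A, optimal V v c A -> (#|sinks A| <= k)%N.
(** Here the atom enters only through these two properties, one keeping it in one piece and one
    cutting off its complement; section [LabelledAtoms] derives both. *)
Hypothesis Z_connected : forall K D z, optimal_at K ->
  closed (arc (spanning K)) D -> z \in Z -> z \in D -> Z \subset D.
Hypothesis Z_separated : forall x, x \notin Z ->
  exists K D, [/\ optimal_at K, closed (arc (spanning K)) D, x \in D & [disjoint D & Z]].

(** The two results have [2 * k] roots together and, being optimal, at most [k] each. *)
Lemma optimal_at_exchange D A B : optimal_at A -> optimal_at B ->
  closed (arc (spanning B)) D -> optimal_at (mix D B A) /\ optimal_at (mix D A B).
Proof.
move=> /andP[oA /eqP cA] /andP[oB /eqP cB] cl.
have o1 := optimal_mix_closed oA oB cl; have o2 := optimal_mix_closedr oA oB cl.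
have := card_sinks_exchange D A B; rewrite cA cB.
have := optimal_card o1; have := optimal_card o2.
by rewrite /optimal_at o1 o2 => h1 h2 h3; split; apply/eqP; lia.
Qed.

Lemma optimal_at_forest A : optimal_at A -> forest (spanning A).
Proof. by case/andP => /optimal_forest/andP[]. Qed.

(** The tree of [r] is closed and meets the atom, so it contains all of it. *)
Lemma atom_connect_root K r i : optimal_at K -> r \in Z -> r \in sinks K ->
  i \in Z -> connect (arc (spanning K)) i r.
Proof.
move=> oK rZ rK iZ; have fK := optimal_at_forest oK.
have cl := closed_connect_sink fK rK.
have /subsetP/(_ i iZ) := Z_connected oK cl rZ ltac:(by rewrite inE connect0).
by rewrite inE.
Qed.

(* Otherwise graft onto K a part D of another minimum forest that contains x
   and avoids Z: this separates u from r, although both lie in the atom Z. *)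
Lemma labelled_no_exit K r u x : optimal_at K -> r \in Z -> r \in sinks K ->
  u \in Z -> arc (spanning K) u x -> x \in Z.
Proof.
move=> oK rZ rK uZ ux; apply/negPn/negP => /Z_separated[K' [D [oK' cl xD dis]]].
have ZD i : i \in Z -> i \notin D.
  by move=> iZ; apply/negP => iD; have := disjointFr dis iD; rewrite iZ.
have [oQ _] := optimal_at_exchange oK oK' cl; have fQ := optimal_at_forest oQ.
have rQ : r \in sinks (mix D K' K).
  by rewrite sinks_mix in_setU in_setD rK (ZD r rZ) orbT.
have ur := atom_connect_root oQ rZ rQ uZ.
have uxQ : arc (spanning (mix D K' K)) u x by rewrite arc_mix (negPf (ZD u uZ)).
have xr : connect (arc (spanning (mix D K' K))) x r by rewrite -(connect_step fQ uxQ).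
(* From [x] on, the path uses arcs of [K'], under which [D] is closed; so it would end in [D], but
   it ends at [r]. *)
have /negP[] := ZD r rZ.
case/connectP: xr => p; elim: p x xD {ux uxQ} => [|y p IH] x xD /=; first by move=> _ ->.
rewrite arc_mix xD => /andP[xy pp]; apply: IH pp.
by rewrite -(cl _ _ xy).
Qed.

(* Among the forests with root r take one whose tree rooted at r is smallest:
   any vertex of that tree outside Z could be cut off by a further exchange. *)
Lemma isolated_atom K0 r : optimal_at K0 -> r \in Z -> r \in sinks K0 ->
  exists2 B, optimal_at B /\ r \in sinks B & closed (arc (spanning B)) Z.
Proof.
move=> oK0 rZ rK0.
pose P B := optimal_at B && (r \in sinks B).
pose Dr B := [set i | connect (arc (spanning B)) i r].
have P0 : P K0 by apply/andP.
case: (arg_minnP (fun B => #|Dr B|) P0) => B /andP[oB rB] minB; exists B => //.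
suff DZ x : x \in Dr B -> x \in Z.
  move=> i j ij; apply/idP/idP => [iZ|jZ]; first exact: (labelled_no_exit oB rZ rB iZ ij).
  apply: DZ; rewrite inE (connect_step (optimal_at_forest oB) ij rB).
  exact: atom_connect_root.
move=> xr; apply/negPn/negP => /Z_separated[K' [D [oK' cl xD dis]]].
have rD : r \notin D by apply/negP => rD; have := disjointFr dis rD; rewrite rZ.
have [oQ _] := optimal_at_exchange oB oK' cl.
have rQ : r \in sinks (mix D K' B).
  by rewrite sinks_mix in_setU in_setD rB rD orbT.
have := minB (mix D K' B); rewrite /P oQ rQ => /(_ isT); apply/negP; rewrite -ltnNge.
(* Arcs of [K'] never leave [D] and [r] is outside it, so a path to [r] avoids [D] and uses arcs of
   [B] only. *)
have H y : connect (arc (spanning (mix D K' B))) y r ->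
    (y \notin D) && connect (arc (spanning B)) y r.
  case/connectP => p; elim: p y => [|z p IH] y /=.
    by move=> _ <-; rewrite rD connect0.
  move=> /andP[yz pp] /(IH _ pp)/andP[zD zr]; move: yz; rewrite arc_mix.
  case: ifP => [yD /cl|_ yz]; first by rewrite yD (negPf zD).
  exact: connect_trans (connect1 yz) zr.
apply: proper_card; apply/properP; split.
  by apply/subsetP => y; rewrite !inE => /H/andP[].
by exists x => //; rewrite inE; apply/negP => /H; rewrite xD.
Qed.

Section Exit.
Variables (B : {set T * T}) (r : T).
Hypotheses (oB : optimal_at B) (rZ : r \in Z) (rB : r \in sinks B)
  (B_isolated : closed (arc (spanning B)) Z).

Lemma isolated_sinks : sinks B :&: Z = [set r].
Proof.
apply/setP => i; rewrite in_setI in_set1; apply/andP/eqP => [[iB iZ]|->//].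
apply: (connect_sink (G := spanning B) iB); exact: atom_connect_root.
Qed.

(** Outside [Z] the forest [B] has all its [k] roots except [r]. *)
Lemma card_sinks_isolated A : #|sinks (mix Z A B)| = (#|sinks A :&: Z| + k.-1)%N.
Proof.
have /andP[_ /eqP cB] := oB; have := cardsID Z (sinks B).
rewrite card_sinks_mix isolated_sinks cards1 cB; lia.
Qed.

Variables (F : {set T * T}) (u w : T).
Hypotheses (oF : optimal V v c F) (uZ : u \in Z) (wZ : w \notin Z)
  (uw : arc (spanning F) u w).

Let Y := mix Z F B.

Let oY : optimal V v c Y.
Proof. by case/andP: oB => oB' _; apply: optimal_mix_closedr. Qed.

Let arcY i j : i \in Z -> arc (spanning Y) i j = arc (spanning F) i j.
Proof. by move=> iZ; rewrite arc_mix iZ. Qed.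

(** A root of [F] in [Z] would give [Y] the full number [k] of roots together with a root in the
    atom, and then [labelled_no_exit] forbids the arc from [u] to [w]. *)
Lemma exit_no_root : sinks F :&: Z = set0.
Proof.
apply/eqP; apply/negPn/negP => /set0Pn[s /setIP[sF sZ]].
have sY : s \in sinks Y by rewrite sinks_mix in_setU in_setI sF sZ.
suff oYk : optimal_at Y.
  by have := labelled_no_exit (u := u) (x := w) oYk sZ sY uZ;
    rewrite arcY // uw (negPf wZ) => /(_ isT).
rewrite /optimal_at oY eqn_leq optimal_card //= card_sinks_isolated.
have : (0 < #|sinks F :&: Z|)%N by apply/card_gt0P; exists s; rewrite inE sF.
lia.
Qed.

(* Of two exits u and u', one is not reached from r inside Z. Grafting onto B
   the part of Z that leaves through it keeps the root r and the number k of
   roots, but the result leaves Z, against labelled_no_exit. *)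
Lemma exit_unique u' w' : u' \in Z -> w' \notin Z -> arc (spanning F) u' w' -> u' = u.
Proof.
move=> u'Z w'Z uw'; apply/eqP/negPn/negP => neq.
have fY : forest (spanning Y) by have /optimal_forest/andP[] := oY.
have fB := optimal_at_forest oB.
(* Inside [Z] both exits are sinks of [I], and [r] reaches only one sink of a forest; [a] is an exit
   it does not reach. *)
pose I := induced (spanning Y) Z.
have fI : forest I by apply: forest_sub fY; apply/subsetP => a; rewrite inE => /andP[].
have arcI i j : arc I i j = [&& arc (spanning Y) i j, i \in Z & j \in Z].
  by rewrite /arc /= inE.
have sI i j : i \in Z -> j \notin Z -> arc (spanning F) i j -> i \in sinks (arcs I).
  move=> iZ jZ ij; apply/sinksP => x; rewrite -[arc _ _ _]/(arc I i x) arcI iZ /=.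
  apply/negP => /andP[ix xZ]; rewrite arcY // in ix.
  have fF : forest (spanning F) by have /optimal_forest/andP[] := oF.
  by move: jZ; rewrite (forest_fun fF ij ix) xZ.
have [a [b [aZ bZ ab nra]]] : exists a b,
    [/\ a \in Z, b \notin Z, arc (spanning F) a b & ~~ connect (arc I) r a].
  have [ru|] := boolP (connect (arc I) r u); last by exists u, w.
  exists u', w'; split=> //; apply: contra neq => ru'.
  by rewrite (sink_unique fI (sI _ _ u'Z w'Z uw') (sI _ _ uZ wZ uw) ru' ru).
have sa := sI _ _ aZ bZ ab.
pose D := [set i in Z | connect (arc I) i a].
have DZ i : i \in D -> i \in Z by rewrite inE => /andP[].
have Yout i j : i \notin D -> arc (spanning Y) i j -> j \notin D.
  move=> iD ij; apply: contra iD => jD; have jZ := DZ _ jD; move: jD; rewrite !inE jZ /=.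
  have [iZ|iZ] := boolP (i \in Z).
    by rewrite (connect_step fI (j := j) _ sa) // arcI ij iZ.
  by move: ij; rewrite arc_mix (negPf iZ) => /B_isolated; rewrite jZ (negPf iZ).
have Yin i j : i \in D -> arc (spanning Y) i j -> (j \in D) || (j \notin Z).
  move=> iD ij; have iZ := DZ _ iD; have [jZ|jZ] := boolP (j \in Z); last by rewrite orbT.
  move: iD; rewrite !inE iZ jZ /= orbF (connect_step fI (j := j) _ sa) //.
  by rewrite arcI ij iZ.
have /optimal_forest sY := oY; have /andP[oB' /eqP cB] := oB.
have sB := optimal_forest oB'.
have sBY : spanning_forest V (mix D B Y) by apply: spanning_forest_mix_outward.
have sYB : spanning_forest V (mix D Y B).
  have /andP[gY _] := sY; have /andP[gB _] := sB.
  rewrite /spanning_forest subgraph_mix //; apply: mix_fun => //.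
  (* Three levels: the rest of [Z] above [D], and [D] above the outside of [Z]. Arcs of [B] do not
     cross the border of [Z], and arcs of [Y] from [D] stay in [D] or leave [Z]. *)
  apply: (acyclic_levels
    (h := fun i => (if i \in D then 1 else if i \in Z then 2 else 0)%N)
    (E := fun n => arc (spanning (if n == 1%N then Y else B)))).
    by move=> n; case: ifP => _; apply: forest_acyclic.
  move=> i j; rewrite arc_mix; case: ifPn => iD ij.
    have := Yin _ _ iD ij; case: ifPn => jD /=; first by right.
    by move=> /negPf->; left.
  have ijZ := B_isolated ij; rewrite -ijZ.
  have [jD|_] := boolP (j \in D); first by rewrite ijZ (DZ _ jD); left.
  by case: (i \in Z); right.
have oM : optimal V v c (mix D Y B) by apply: optimal_exchange.
have rD : r \notin D by rewrite inE rZ.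
have rM : r \in sinks (mix D Y B) by rewrite sinks_mix in_setU in_setD rB rD orbT.
(* [Y] has no root in [D] by [exit_no_root], and [B] loses none, as its only root in [Z] is [r],
   outside [D]. *)
have cM : #|sinks (mix D Y B)| = k.
  rewrite card_sinks_mix.
  have -> : sinks Y :&: D = set0.
    apply/setP => i; rewrite !in_setI in_set0; apply/andP => -[iY iD].
    have iZ := DZ _ iD; move: iY; rewrite sinks_mix in_setU in_setD iZ orbF exit_no_root.
    by rewrite inE.
  rewrite cards0 add0n -cB; apply/eq_card => i; rewrite in_setD andbC.
  case iB: (i \in sinks B) => //=; apply/negP => iD.
  have : i \in sinks B :&: Z by rewrite inE iB DZ.
  by rewrite isolated_sinks inE => /eqP ir; move: rD; rewrite -ir iD.
have oMk : optimal_at (mix D Y B) by rewrite /optimal_at oM cM eqxx.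
have aD : a \in D by rewrite inE aZ connect0.
have := labelled_no_exit (u := a) (x := b) oMk rZ rM aZ.
by rewrite arc_mix aD arcY // ab (negPf bZ) => /(_ isT).
Qed.

End Exit.
End IsolatedAtom.

(** * Trees on an atom *)

Section AtomTrees.
Local Open Scope ring_scope.
Variables (R : realFieldType) (T : finType) (V : rel T) (v : T -> T -> R).
Implicit Types (S : digraph T) (D Z : {set T}) (A B F Q : {set T * T}).

Lemma forest_spanning S : subgraph V S -> forest S -> spanning_forest V (arcs S).
Proof.
move=> /forallP sS fS; apply/andP; split; last exact: fS.
apply/forallP => i; apply/forallP => j; apply/implyP => ij.
by have /forallP/(_ j)/implyP/(_ ij)/and3P[-> _ _] := sS i; rewrite !inE.
Qed.

Lemma weight_on_arcs Z S : (forall a, a \in arcs S -> a.1 \in Z) ->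
  weight v S = weight_on v Z S.
Proof.
move=> tS; apply: eq_bigl => a; rewrite inE andbT.
by case aS: (a \in arcs S); rewrite // tS.
Qed.

Lemma weight_on_eq Z S S' : (forall a, a.1 \in Z -> (a \in arcs S) = (a \in arcs S')) ->
  weight_on v Z S = weight_on v Z S'.
Proof.
move=> eS; apply: eq_bigl => a; case aZ: (a.1 \in Z); last by rewrite !andbF.
by rewrite eS.
Qed.

Lemma outset_spanning Q S Z :
  (forall a, a.1 \in Z -> (a \in Q) = (a \in arcs S)) ->
  outset Z (spanning Q) = outset Z S.
Proof.
move=> eQ; apply/setP => j; rewrite !inE; congr (_ && _).
by apply: eq_existsb => i; case iZ: (i \in Z) => //=; exact: eQ.
Qed.

Lemma out_restr_spanning Q S Z : (forall a, a \in arcs S -> a.1 \in Z) ->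
  (forall a, a.1 \in Z -> (a \in Q) = (a \in arcs S)) ->
  out_restr (spanning Q) Z = (Z :|: outset Z S, arcs S).
Proof.
move=> tS eQ; congr pair; first by rewrite (outset_spanning eQ).
apply/setP => a; rewrite inE /=; case aZ: (a.1 \in Z); rewrite ?andbT ?andbF ?eQ //.
by apply/esym/negP => /tS; rewrite aZ.
Qed.

Lemma trees_in_closed S Z i j : S \in trees_in V Z -> arc S i j -> (i \in Z) && (j \in Z).
Proof. by rewrite inE => /and3P[sS _ /eqP <-]; exact: subgraph_vset sS. Qed.

Lemma trees_in_root S Z : S \in trees_in V Z ->
  exists2 r, sinks (arcs S) :&: Z = [set r]
    & forall i, i \in Z -> connect (arc S) i r.
Proof.
rewrite inE => /and3P[sS tS /eqP <-]; have [r rS] := tree_root sS tS.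
exists r; first by rewrite setIC -rootsE.
by move=> i; apply: (tree_connect sS tS rS).
Qed.

Lemma trees_out_root S Z : S \in trees_out V Z -> exists w,
  [/\ w \in outset Z S, vset S = Z :|: outset Z S, forall a, a \in arcs S -> a.1 \in Z,
      sinks (arcs S) :&: Z = set0 & forall i, i \in Z -> connect (arc S) i w].
Proof.
rewrite inE => /and5P[sS tS /eqP cS ZS /andP[iS dS]].
have [r rS] := tree_root sS tS; move: dS; rewrite rS disjoints1 => rZ.
have /andP[rV rsink] : (r \in vset S) && (r \in sinks (arcs S)).
  by have := set11 r; rewrite -rS rootsE inE.
have SZ : vset S = r |: Z.
  apply/esym/eqP; rewrite eqEcard cS cardsU1 rZ leqnn andbT.
  by apply/subsetP => i /setU1P[->|/(subsetP ZS)].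
have noarc j : ~~ arc S r j by move/sinksP: rsink => /(_ j).
have tZ i j : arc S i j -> (i \in Z) && ((j == r) || (j \in Z)).
  move=> ij; have := subgraph_vset sS ij; rewrite SZ !in_setU1.
  have [eir|_] := eqVneq i r; last by [].
  by have := noarc j; rewrite -eir ij.
(* The root [u] of the tree on [Z] is not a root of [S]; its arc in [S] must leave [Z], and [r] is
   the only vertex of [S] there. *)
have out : outset Z S = [set r].
  apply/setP => j; rewrite !inE; apply/andP/eqP => [[jZ /existsP[i /andP[iZ ij]]]|->].
    by have := tZ _ _ ij; rewrite (negPf jZ) orbF => /andP[_ /eqP].
  split=> //; have [u uI _] := trees_in_root iS; apply/existsP; exists u.
  have /setIP[usink uZ] : u \in sinks (arcs (induced S Z)) :&: Z by rewrite uI set11.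
  rewrite uZ /=; have : u \notin roots S by rewrite rS inE; apply: contra rZ => /eqP<-.
  rewrite inE (subsetP ZS) //= negb_forall => /existsP[x]; rewrite negbK => ux.
  have [xZ|xZ] := boolP (x \in Z).
    move/sinksP: usink => /(_ x); rewrite /arc /= inE /= uZ xZ.
    by rewrite (_ : (u, x) \in arcs S).
  by have := tZ _ _ ux; rewrite (negPf xZ) orbF => /andP[_ /eqP <-].
exists r; split=> //.
- by rewrite out set11.
- by rewrite out setUC.
- by case=> i j /(tZ i j)/andP[].
- apply/setP => i; rewrite !in_setI in_set0; apply/andP => -[iS' iZ].
  have : i \in roots S by rewrite rootsE inE iS' (subsetP ZS).
  by rewrite rS inE => /eqP ir; move: rZ; rewrite -ir iZ.
- by move=> i iZ; apply: (tree_connect sS tS rS); apply: (subsetP ZS).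
Qed.

Lemma induced_trees_in B Z r : spanning_forest V B -> sinks B :&: Z = [set r] ->
  (forall i j, i \in Z -> arc (spanning B) i j -> j \in Z) ->
  induced (spanning B) Z \in trees_in V Z.
Proof.
move=> /andP[/forallP sB fB] rB cl; rewrite inE /= setTI eqxx andbT.
have sI : subgraph V (induced (spanning B) Z).
  apply/forallP => i; apply/forallP => j; apply/implyP.
  rewrite /arc /= !inE /= => /andP[ij /andP[-> ->]].
  by have /forallP/(_ j)/implyP/(_ ij)/and3P[-> _ _] := sB i.
have fI : forest (induced (spanning B) Z).
  by apply: forest_sub fB; apply/subsetP => a; rewrite inE => /andP[].
rewrite sI /=; apply: (one_root_tree (r := r) sI fI).
rewrite rootsE -rB [RHS]setIC [vset _]setTI.
apply/setP => i; rewrite in_setI [RHS]in_setI.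
case iZ: (i \in Z) => //=; rewrite !inE; apply: eq_forallb => j; rewrite !inE /= iZ /=.
by case ij: (_ \in B); rewrite //= (cl i j).
Qed.

(** Every vertex of [Z] has an arc, and only that of [u] leaves [Z]: so [w] is the only root of the
    outgoing restriction and [u] the only root inside [Z]. *)
Lemma out_restr_trees_out F Z u w : spanning_forest V F -> sinks F :&: Z = set0 ->
  u \in Z -> w \notin Z -> arc (spanning F) u w ->
  (forall i j, i \in Z -> j \notin Z -> arc (spanning F) i j -> i = u) ->
  out_restr (spanning F) Z \in trees_out V Z.
Proof.
move=> /andP[/forallP sF fF] rF uZ wZ uw exit; set O := out_restr _ _.
have arcO i j : arc O i j = (i \in Z) && arc (spanning F) i j.
  by rewrite /arc /= inE andbC.
have out : outset Z (spanning F) = [set w].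
  apply/setP => j; rewrite !inE; apply/andP/eqP => [[jZ /existsP[i /andP[iZ ij]]]|->].
    by have := exit _ _ iZ jZ ij => iu; move: ij; rewrite iu => /(forest_fun fF uw).
  by split=> //; apply/existsP; exists u; rewrite uZ.
have vO : vset O = w |: Z by rewrite /O /out_restr /= out setUC.
have hasarc i : i \in Z -> exists j, arc (spanning F) i j.
  move=> iZ; apply/existsP; apply: contraT; rewrite negb_exists => /forallP/sinksP iF.
  by have := in_set0 i; rewrite -rF in_setI iF iZ.
have head i j : i \in Z -> arc (spanning F) i j -> (j == w) || (j \in Z).
  move=> iZ ij; have [|jZ] := boolP (j \in Z); first by rewrite orbT.
  have iu := exit _ _ iZ jZ ij; rewrite iu in ij.
  by rewrite (forest_fun fF ij uw) eqxx.
have sO : subgraph V O.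
  apply/forallP => i; apply/forallP => j; apply/implyP.
  rewrite arcO vO !in_setU1 => /andP[iZ ij]; rewrite iZ orbT (head i) //= andbT.
  by have /forallP/(_ j)/implyP/(_ ij)/andP[] := sF i.
have fO : forest O.
  by apply: forest_sub fF; apply/subsetP => a; rewrite inE => /andP[].
have rO : roots O = [set w].
  apply/setP => i; rewrite rootsE vO in_setI in_setU1 in_set1.
  have [->|iw] := eqVneq i w.
    by rewrite /=; apply/sinksP => j; rewrite -[arc _ _ _]/(arc O w j) arcO (negPf wZ).
  apply/negP => /andP[/= iZ /sinksP iO]; have [j ij] := hasarc _ iZ.
  by have := iO j; rewrite -[arc _ _ _]/(arc O i j) arcO iZ ij.
pose I := induced O Z.
have arcI i j : arc I i j = [&& arc (spanning F) i j, i \in Z & j \in Z].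
  by rewrite /arc /= !inE /=; case: (i \in Z); rewrite /= ?andbT ?andbF.
have vI : vset I = Z by rewrite -[vset I]/(vset O :&: Z) vO; apply/setIidPr/subsetUr.
have sI : subgraph V I.
  apply/forallP => i; apply/forallP => j; apply/implyP.
  rewrite arcI vI => /and3P[ij -> ->].
  by have /forallP/(_ j)/implyP/(_ ij)/andP[-> _] := sF i.
have fI : forest I.
  by apply: forest_sub fO; apply/subsetP => a; rewrite inE => /andP[].
have rI : roots I = [set u].
  apply/setP => i; rewrite rootsE vI in_setI in_set1.
  apply/andP/eqP => [[iZ /sinksP iI]|->].
    have [j ij] := hasarc _ iZ; apply: (exit i j) => //.
    by have := iI j; rewrite -[arc _ _ _]/(arc I i j) arcI ij iZ.
  split=> //; apply/sinksP => j; rewrite -[arc _ _ _]/(arc I u j) arcI.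
  by apply: contra wZ => /and3P[uj _ jZ]; rewrite (forest_fun fF uw uj).
rewrite inE sO (one_root_tree sO fO rO) vO cardsU1 wZ eqxx subsetUr /=.
rewrite inE -/I sI (one_root_tree sI fI rI) vI eqxx /=.
by rewrite rO disjoints1.
Qed.

(* First graft the tree of B containing Z onto H, then pass to B tree by tree. *)
Lemma optimal_extend c B H Z r l : optimal V v c B -> optimal V v c H ->
  (#|sinks H| < l <= #|sinks B|)%N -> r \in sinks B ->
  (forall i, i \in Z -> connect (arc (spanning B)) i r) ->
  exists2 Q, optimal V v c Q /\ #|sinks Q| = l
    & forall a, a.1 \in Z -> (a \in Q) = (a \in B).
Proof.
move=> oB oH /andP[Hl lB] rB rZ.
have fB : forest (spanning B) by have /optimal_forest/andP[] := oB.
pose D := [set i | connect (arc (spanning B)) i r].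
have oX := optimal_mix_closed oH oB (closed_connect_sink fB rB : closed _ D).
have [|D' cl lD'] := @sinks_interpolation _ (mix D B H) B l fB.
  rewrite lB andbT card_sinks_mix; apply: leq_trans Hl.
  rewrite -add1n leq_add ?subset_leq_card ?subsetDl // -(cards1 r).
  apply/subset_leq_card/subsetP => i; rewrite in_setI in_set1 [i \in D]inE.
  by move=> /andP[iB] /(connect_sink (G := spanning B) iB)->.
exists (mix D' B (mix D B H)); first by split=> //; apply: optimal_mix_closed.
(* [Z] lies in [D], where the first mix already takes the arcs of [B]; the second can only bring in
   arcs of [B] again. *)
by move=> a aZ; rewrite !inE rZ // if_same.
Qed.

End AtomTrees.

(** * Atoms of the tree algebra and exchanges *)

Section LabelledAtoms.
Local Open Scope ring_scope.
Variables (R : realFieldType) (T : finType) (V : rel T) (v : T -> T -> R).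
Variables (c : R) (k : nat) (Z : {set T}).
Implicit Types (C D : {set T}) (A K : {set T * T}).
Hypothesis min_optimal :
  forall A, spanning A \in min_forests V v k = optimal_at V v c k A.
Hypothesis Z_atom : Z \in labeled_atoms V v k.

Let X := \bigcup_(F in min_forests V v k) [set vset G | G in trees_of F].

Let Z_atom' : Z \in atoms_of (generated_algebra X).
Proof. by move: Z_atom; rewrite inE => /andP[]. Qed.

Let mem_X K C : optimal_at V v c k K ->
  C \in [set vset G | G in trees_of (spanning K)] -> C \in X.
Proof. by rewrite -min_optimal => oK CK; apply/bigcupP; exists (spanning K). Qed.

Let min_forestE F : F \in min_forests V v k ->
  exists2 A, F = spanning A & optimal_at V v c k A.
Proof.
move=> FM; have /minimizersP[/forests_spanning FA _] := FM.
by exists (arcs F); rewrite // -min_optimal -FA.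
Qed.

Lemma labelled_atom_connected K D z : optimal_at V v c k K ->
  closed (arc (spanning K)) D -> z \in Z -> z \in D -> Z \subset D.
Proof.
move=> oK cl zZ zD; have [C CK zC] := component_exists K z.
have [_ CD] := mem_component CK; apply: subset_trans (CD _ _ cl zC zD).
have /orP[/eqP ZC|//] := atom_meet Z_atom' (mem_X oK CK).
by have := in_set0 z; rewrite -ZC inE zZ zC.
Qed.

(** Some tree separates [x] from a vertex [z] of the atom. It contains the atom or misses it, so its
    complement or itself serves as [D]. *)
Lemma labelled_atom_separated x : x \notin Z -> exists K D,
  [/\ optimal_at V v c k K, closed (arc (spanning K)) D, x \in D & [disjoint D & Z]].
Proof.
move=> xZ; have /set0Pn[z zZ] : Z != set0.
  by have := Z_atom'; rewrite inE => /and3P[].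
have [C CX sep] := atom_separated Z_atom' zZ xZ.
have /bigcupP[F /min_forestE[K -> oK] CK] := CX.
have [cl _] := mem_component CK; have meet := atom_meet Z_atom' CX.
exists K; have [zC|zC] := boolP (z \in C).
  exists (~: C); split=> //.
  - by move=> i j /cl; rewrite !inE => ->.
  - by rewrite inE; move: sep; rewrite zC; case: (x \in C).
  case/orP: meet => [/eqP ZC|ZC]; last by rewrite disjoint_sym disjoints_subset setCK.
  by have := in_set0 z; rewrite -ZC inE zZ zC.
exists C; split=> //; first by move: sep; rewrite (negPf zC); case: (x \in C).
case/orP: meet => [/eqP ZC|/subsetP/(_ z zZ)]; last by rewrite (negPf zC).
by rewrite -setI_eq0 setIC ZC.
Qed.

Lemma labelled_atom_root :
  exists K r, [/\ optimal_at V v c k K, r \in Z & r \in sinks K].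
Proof.
move: Z_atom; rewrite inE => /andP[_ /existsP[F /andP[/min_forestE[K -> oK]]]].
case/existsP => G /andP[GK /set0Pn[r /setIP[rZ rG]]].
by exists K, r; split=> //; apply: labelled_root GK rG.
Qed.

End LabelledAtoms.

Theorem theorem10 (R : realFieldType) (T : finType) (V : rel T)
    (v : T -> T -> R)
    (V_loopless : irreflexive V)
    (V_spanning_tree : trees_in V [set: T] != set0)
    (m k : nat)
    (m_ge1 : (1 <= m)%N) (k_le : (k <= #|T| - 1)%N) (k_gt_m : (k - m > 1)%N)
    (phi_m : (phi V v (m - 1) - phi V v m > phi V v m - phi V v (m + 1))%E)
    (phi_eq : forall j : nat, (m <= j <= k - 1)%N ->
       (phi V v j - phi V v (j + 1) = phi V v m - phi V v (m + 1))%E)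
    (phi_k : (phi V v (k - 1) - phi V v k > phi V v k - phi V v (k + 1))%E)
    (Z : {set T}) (Z_atom : Z \in labeled_atoms V v k)
    (F G : digraph T)
    (F_min : F \in min_forests V v (k - 1)) (F_out : outset Z F != set0)
    (G_min : G \in min_forests V v (k - 1)) (G_out : outset Z G = set0)
    (l : nat) (l_range : (m + 1 <= l <= k - 1)%N) :
  ((exists H : digraph T,
      [/\ H \in min_forests V v l, outset Z H != set0
        & out_restr H Z \in min_trees_out V v Z]) /\
   (forall S : digraph T, S \in min_trees_out V v Z ->
      exists Q : digraph T, Q \in min_forests V v l /\ out_restr Q Z = S)) /\
  ((exists S : digraph T,
      [/\ S \in min_forests V v l, outset Z S = set0
        & induced S Z \in min_trees_in V v Z]) /\
   (forall S : digraph T, S \in min_trees_in V v Z ->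
      exists Q : digraph T,
        [/\ Q \in min_forests V v l, out_restr Q Z = S & induced Q Z = S])).
Proof.
have [kT mT] : (0 < k)%N /\ (0 < m <= #|T|)%N by split; lia.
have [mm mk mk1] : [/\ m <= m <= k, m <= k <= k & m <= k - 1 <= k]%N by split; lia.
have [ml lk1 lk] : [/\ m < l, l <= k.-1 <= k & l <= k <= k]%N by split; lia.
have mlk : (m <= l <= k)%N by lia.
have [c [min_optimal card_le]] :=
  min_forests_optimal V_spanning_tree m_ge1 k_le k_gt_m phi_eq phi_k.
have min_optimal_k A : spanning A \in min_forests V v k = optimal_at V v c k A.
  exact: min_optimal.
have conn := labelled_atom_connected min_optimal_k Z_atom.
have sep := labelled_atom_separated min_optimal_k Z_atom.
have [K0 [r [oK0 rZ rK0]]] := labelled_atom_root min_optimal_k Z_atom.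
have [B [oB rB] BZ] := isolated_atom card_le conn sep oK0 rZ rK0.
have sinksB := isolated_sinks conn oB rZ rB.
have card_mix A := card_sinks_isolated conn oB rZ rB A.
have /andP[oB' /eqP cB] := oB.
have sB := optimal_forest oB'.
(* This forest is the lower end of the interpolation; grafting one tree onto it gives at most
   [m + 1] roots, hence at most [l]. *)
have [H oH cH] : exists2 H, optimal V v c H & #|sinks H| = m.
  have [H Hm _] := forests_min v V_spanning_tree mT.
  by move: Hm; rewrite min_optimal //; case/andP => oH /eqP; exists H.
have [A eF] : exists A, F = spanning A.
  by have /minimizersP[/forests_spanning ->] := F_min; exists (arcs F).
move: F_min F_out; rewrite {}eF min_optimal //.
case/andP=> oA _ /set0Pn[w]; rewrite inE => /andP[wZ /existsP[u /andP[uZ uw]]].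
have sA := optimal_forest oA.
have sinksA := exit_no_root card_le conn sep oB rZ rB BZ oA uZ wZ uw.
have exitA i j : i \in Z -> j \notin Z -> arc (spanning A) i j -> i = u.
  exact: (exit_unique card_le conn sep oB rZ rB BZ oA uZ wZ uw).
have A_out := out_restr_trees_out sA sinksA uZ wZ uw exitA.
have B_in : induced (spanning B) Z \in trees_in V Z.
  by apply: induced_trees_in sB sinksB _ => i j iZ /BZ <-.
(* Serves both kinds of trees, with [l'] equal to [k - 1] or [k]. For a tree leaving [Z], [t] is the
   outside vertex and need not be a root of the mix; its path is followed to the root [s]. *)
have graft S t l' : spanning_forest V (mix Z (arcs S) B) ->
    (forall a, a \in arcs S -> a.1 \in Z) ->
    optimal V v c (mix Z (arcs S) B) -> #|sinks (mix Z (arcs S) B)| = l' ->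
    (forall i, i \in Z -> connect (arc S) i t) -> (l <= l' <= k)%N ->
    exists2 Q, spanning Q \in min_forests V v l
      & forall a, a.1 \in Z -> (a \in Q) = (a \in arcs S).
  move=> sQ tS oQ cQ St /andP[ll' _].
  have [s ts sQs] := forest_sink t (proj2 (andP sQ)).
  have hl : (#|sinks H| < l <= #|sinks (mix Z (arcs S) B)|)%N by rewrite cH cQ ml.
  have [|Q [oQl cQl] eQ] := optimal_extend oQ oH hl sQs (Z := Z).
    move=> i iZ; apply: connect_trans ts; apply: connect_sub (St i iZ) => x y xy.
    by apply: connect1; rewrite arc_mix (tS _ xy).
  exists Q; first by rewrite min_optimal // oQl cQl eqxx.
  by move=> a aZ; rewrite eQ // inE aZ.
have outP S : S \in min_trees_out V v Z -> exists Q : digraph T,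
    [/\ Q \in min_forests V v l, outset Z Q != set0 & out_restr Q Z = S].
  move=> /minimizersP[S_out minS].
  have [t [tS_out vS tS sinksS St]] := trees_out_root S_out.
  have [sS fS] : subgraph V S /\ forest S.
    by move: S_out; rewrite inE => /and5P[-> /andP[-> _]].
  have sSA := forest_spanning sS fS.
  have sQ : spanning_forest V (mix Z (arcs S) B).
    exact: spanning_forest_mix_closedr.
  have cQ : #|sinks (mix Z (arcs S) B)| = k.-1 by rewrite card_mix sinksS cards0.
  have oY : optimal V v c (mix Z A B) by apply: optimal_mix_closedr.
  (* Compare with [mix Z A B]: both have [k - 1] roots and agree outside [Z], and on [Z] the tree
     [S] weighs no more than the outgoing restriction of [A]. *)
  have oQ : optimal V v c (mix Z (arcs S) B).
    apply: (cost_optimal oY sQ); rewrite /cost cQ card_mix sinksA cards0.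
    rewrite lerD2r !weight_mix lerD2r.
    rewrite -[leLHS](weight_on_arcs v tS) (le_trans (minS _ A_out)) //.
    rewrite (@weight_on_arcs _ _ v Z); last by move=> a; rewrite inE => /andP[].
    by rewrite (@weight_on_eq _ _ v Z _ (spanning A)) // => a aZ; rewrite inE aZ andbT.
  have [Q Ql eQ] := graft S t k.-1 sQ tS oQ cQ St lk1.
  exists (spanning Q); split=> //; last first.
    by rewrite (out_restr_spanning tS eQ) -vS; case: (S).
  by rewrite (outset_spanning eQ); apply/set0Pn; exists t.
have inP S : S \in min_trees_in V v Z -> exists Q : digraph T,
    [/\ Q \in min_forests V v l, outset Z Q = set0, out_restr Q Z = S & induced Q Z = S].
  move=> /minimizersP[S_in minS].
  have [t sinksS St] := trees_in_root S_in.
  have [sS fS vS] : [/\ subgraph V S, forest S & vset S = Z].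
    by move: S_in; rewrite inE => /and3P[-> /andP[-> _] /eqP].
  have SZ i j : arc S i j -> (i \in Z) && (j \in Z) := trees_in_closed S_in.
  have tS a : a \in arcs S -> a.1 \in Z by case: a => i j /SZ/andP[].
  have sSA := forest_spanning sS fS.
  have sQ : spanning_forest V (mix Z (arcs S) B).
    exact: spanning_forest_mix_closedr.
  have cQ : #|sinks (mix Z (arcs S) B)| = k.
    by rewrite card_mix sinksS cards1 add1n prednK.
  (* Compare with [B] itself, whose restriction to [Z] is one of the trees over which [S] is minimal
     and, [Z] being closed, carries all its arcs with tail in [Z]. *)
  have oQ : optimal V v c (mix Z (arcs S) B).
    apply: (cost_optimal oB' sQ); rewrite /cost cQ cB.
    rewrite lerD2r weight_mix (weight_split v Z B) lerD2r.
    rewrite -[leLHS](weight_on_arcs v tS) (le_trans (minS _ B_in)) //.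
    rewrite (@weight_on_arcs _ _ v Z); last by move=> a; rewrite inE => /and3P[].
    rewrite (@weight_on_eq _ _ v Z _ (spanning B)) // => -[i j] /= iZ; rewrite inE /= iZ.
    by case ij: (_ \in B); rewrite //= -(BZ i j).
  have [Q Ql eQ] := graft S t k sQ tS oQ cQ St lk.
  have out0 : outset Z S = set0.
    apply/setP => j; rewrite !inE; apply/negP => /andP[jZ /existsP[i /andP[_ /SZ]]].
    by rewrite (negPf jZ) andbF.
  exists (spanning Q); split=> //; first by rewrite (outset_spanning eQ).
    by rewrite (out_restr_spanning tS eQ) out0 setU0 -vS; case: (S).
  rewrite /induced setTI -vS [RHS]surjective_pairing; congr pair.
  apply/setP => -[i j]; rewrite inE /= vS.
  apply/and3P/idP => [[ij iZ jZ]|ij]; first by rewrite -eQ.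
  by have /andP[iZ jZ] := SZ _ _ ij; rewrite iZ jZ eQ.
(* The trees supplied by [A] and [B] make both families nonempty, so the existence claims follow
   from the ones about all minimum trees. *)
have [S0 S0_min] : exists S, S \in min_trees_out V v Z.
  by apply: minimizers_neq0; apply/set0Pn; exists (out_restr (spanning A) Z).
have [S1 S1_min] : exists S, S \in min_trees_in V v Z.
  by apply: minimizers_neq0; apply/set0Pn; exists (induced (spanning B) Z).
split; split.
- by have [Q [Ql Qo QS]] := outP _ S0_min; exists Q; rewrite QS.
- by move=> S /outP[Q [Ql _ QS]]; exists Q.
- by have [Q [Ql Qo _ QS]] := inP _ S1_min; exists Q; rewrite QS.
- by move=> S /inP[Q [Ql _ QS QS']]; exists Q.
Qed.
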